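(* There exist constants $c_n>0$ and $c_n'>0$ depending only on $n$ such that the following holds. Let $\mathcal{B}$ be a homothecy invariant basis consisting of convex sets in $\mathbb{R}^n$. For every $\alpha\in(0,1)$, every measurable set $E\subset\mathbb{R}^n$ of finite measure, and every $\delta\in(0,c_n'(1-\alpha)]$, \[ \mathcal{H}_{\mathcal{B},\alpha}(E)\subseteq\mathcal{H}_{\mathcal{B},\,\alpha\left(1+c_n\min(\alpha,1-\alpha)^{2n}\delta\right)}\big(\mathcal{H}_{\mathcal{B},\,1-3n^{3n/2}\delta}(E)\big). \]
   Context: A basis $\mathcal B$ is a collection of bounded open sets in $\mathbb R^n$; it is homothecy invariant if every translate and every positive dilate of a member of $\mathcal B$ belongs to $\mathcal B$. $M_{\mathcal B}f(x)=\sup_{x\in R\in\mathcal B}\frac{1}{|R|}\int_R|f|$ if $x\in\bigcup_{B\in\mathcal B}B$, else $0$. For measurable $E$ and $\beta>0$, $\mathcal H_{\mathcal B,\beta}(E)=\{x\in\mathbb R^n: M_{\mathcal B}\chi_E(x)>\beta\}$. *)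

(* Defs.v *)
From HB Require Import structures.
From mathcomp Require Import all_boot all_order all_algebra.
From mathcomp Require Import all_classical all_reals all_analysis.
Set Implicit Arguments. Unset Strict Implicit. Unset Printing Implicit Defensive.
Import Order.TTheory GRing.Theory Num.Theory.
Import numFieldNormedType.Exports.
Local Open Scope classical_set_scope.
Local Open Scope ring_scope.

Section Defs.
Variables (R : realType) (n : nat).
Local Notation V := 'rV[R]_n.

Definition box (a b : V) : set V :=
  [set x | forall i : 'I_n, a ord0 i <= x ord0 i < b ord0 i].
Definition box_vol (a b : V) : R := \prod_(i < n) Num.max 0 (b ord0 i - a ord0 i).

Definition leb_outer (A : set V) : \bar R :=
  ereal_inf [set s | exists a b : nat -> V,
    A `<=` \bigcup_k box (a k) (b k) /\
    s = (\sum_(0 <= k <oo) (box_vol (a k) (b k))%:E)%E].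

Definition leb_measurable (E : set V) : Prop :=
  forall T : set V, leb_outer T = (leb_outer (T `&` E) + leb_outer (T `&` ~` E))%E.

Definition is_basis (B : set (set V)) : Prop :=
  forall S, B S -> open S /\ bounded_set S.

Definition homothecy_invariant (B : set (set V)) : Prop :=
  forall S, B S -> forall (v : V) (r : R), 0 < r -> B [set v + r *: x | x in S].

Definition convex_basis (B : set (set V)) : Prop :=
  forall S, B S -> @convex_set R V S.

(* M_B chi_E (x) = sup_{x in S in B} (1/|S|) int_S chi_E = sup |S /\ E|/|S|,
   and 0 if x lies in no member of B *)
Definition max_chi (B : set (set V)) (E : set V) (x : V) : \bar R :=
  if x \in \bigcup_(S in B) S then
    ereal_sup [set (fine (leb_outer (S `&` E)) / fine (leb_outer S))%:E
              | S in [set S | B S /\ S x]]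
  else 0%E.

Definition halo (B : set (set V)) (beta : R) (E : set V) : set V :=
  [set x | (beta%:E < max_chi B E x)%E].

End Defs.

(* Main.v *)
(* Take S in B containing x with |S /\ E| > alpha |S|.  For a point y of S /\ E,
   shrink S towards y by a fixed ratio q with q^n > 1 - delta.  At almost every y
   the density of E in the shrunken copies eventually exceeds 1 - delta; the last
   copy before this happens has density in (1 - 2 delta, 1 - delta], so it lies in
   the inner halo F and still misses E by a proportion delta.  A Vitali selection
   of disjoint such copies, all inside S, shows that F /\ S exceeds E /\ S by a
   proportion at least delta / C of its measure.  If instead the density of E in
   S itself is above 1 - delta, then S is contained in F.
   Engulfing of convex sets with a dimensional constant comes from a simplex in S
   of nearly maximal volume: S + S - S is covered by (12 n + 1)^n translates of S. *)

Require Import Defs.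
From HB Require Import structures.
From mathcomp Require Import all_boot all_order all_algebra.
From mathcomp Require Import all_classical all_reals all_analysis.
From mathcomp Require Import perm ring lra.
Set Implicit Arguments. Unset Strict Implicit. Unset Printing Implicit Defensive.
Import Order.TTheory GRing.Theory Num.Theory.
Import numFieldNormedType.Exports.
Local Open Scope classical_set_scope.
Local Open Scope ring_scope.

(** * Lebesgue outer measure and Caratheodory measurability of open sets *)

Section LebesgueOuterMeasure.
Variables (R : realType) (n : nat).
Local Notation V := 'rV[R]_n.+1.
Local Notation mu := (@leb_outer R n.+1).

Lemma box_vol_ge0 (a b : V) : 0 <= box_vol a b.
Proof. by apply: prodr_ge0 => i _; rewrite le_max lexx. Qed.

Lemma leb_outer_le_cover (A : set V) (a b : nat -> V) :
  A `<=` \bigcup_k box (a k) (b k) ->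
  (mu A <= \sum_(0 <= k <oo) (box_vol (a k) (b k))%:E)%E.
Proof. by move=> Aab; apply: ereal_inf_lbound; exists a, b. Qed.

Lemma leb_outer_cover_lt (A : set V) (x : \bar R) : (mu A < x)%E ->
  exists a b : nat -> V, A `<=` \bigcup_k box (a k) (b k) /\
    (\sum_(0 <= k <oo) (box_vol (a k) (b k))%:E < x)%E.
Proof. by move=> /ereal_inf_lt[_ [a [b [Aab ->]]] sx]; exists a, b. Qed.

Lemma leb_outer_ge0 (A : set V) : (0 <= mu A)%E.
Proof.
apply: le_ereal_inf_tmp => _ [a [b [_ ->]]].
by apply: nneseries_ge0 => k _ _; rewrite lee_fin box_vol_ge0.
Qed.

Lemma le_leb_outer : {homo mu : A B / A `<=` B >-> (A <= B)%E}.
Proof.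
move=> A B AB; apply: le_ereal_inf => _ [a [b [Bab ->]]].
by exists a, b; split=> //; exact: subset_trans Bab.
Qed.

(** The dimension is [n.+1], so the box from 0 to 0 has volume 0; in dimension 0 the empty product
    would give 1. *)
Lemma leb_outer0 : mu set0 = 0%E.
Proof.
apply/eqP; rewrite eq_le leb_outer_ge0 andbT.
apply: (le_trans (leb_outer_le_cover (a := fun=> 0) (b := fun=> 0) _)) => //.
rewrite eseries0// => k _ _; rewrite /box_vol big_ord_recl mxE subrr.
by rewrite maxxx mul0r.
Qed.

Lemma leb_outer_sigma_subadditive : sigma_subadditive mu.
Proof.
move=> A; have [[i Ai]|/forallNP Afin] := pselect (exists i, mu (A i) = +oo%E).
  rewrite (eseries_pinfty _ _ Ai) ?leey// => k _.
  by rewrite -ltNye (lt_le_trans _ (leb_outer_ge0 _)).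
apply/lee_addgt0Pr => e e0.
apply: le_trans (epsilon_trick _ _ (ltW e0)); last by move=> k; exact: leb_outer_ge0.
have /choice[G GP] i : exists ab : (nat -> V) * (nat -> V),
    A i `<=` \bigcup_k box (ab.1 k) (ab.2 k) /\
    (\sum_(0 <= k <oo) (box_vol (ab.1 k) (ab.2 k))%:E
      <= mu (A i) + (e / (2 ^ i.+1)%:R)%:E)%E.
  have /leb_outer_cover_lt[a [b [Aab /ltW ab]]] :
      (mu (A i) < mu (A i) + (e / (2 ^ i.+1)%:R)%:E)%E.
    rewrite lteDl ?lte_fin ?divr_gt0 ?ltr0n ?expn_gt0//.
    by rewrite ge0_fin_numE ?leb_outer_ge0 ?ltey//; apply/eqP/Afin.
  by exists (a, b).
(* The covers of the sets [A i], each within [e / 2 ^ i.+1] of optimal, are merged into one sequence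
   of boxes along a bijection between [nat] and pairs; the double series is then rearranged as an
   unordered sum. *)
have /card_esym/card_set_bijP[f bijf] := card_nat2.
pose v p := (box_vol ((G p.1).1 p.2) ((G p.1).2 p.2))%:E.
have v0 p : (0 <= v p)%E by rewrite lee_fin box_vol_ge0.
apply: (@le_trans _ _ (\sum_(0 <= k <oo) v (f k))%E).
  apply: leb_outer_le_cover => x [i _ /(GP i).1[j _ Gx]].
  have [k _ fk] : [set f k | k in setT] (i, j) by rewrite (image_eq bijf).
  by exists k => //; rewrite fk.
rewrite nneseries_esumT// -(reindex_esum _ _ _ _ bijf)//.
rewrite (_ : setT = setT `*`` (fun=> setT)); last by apply/seteqP; split.
rewrite -(esum_esum (a := fun i j => v (i, j)))//.
under eq_esum do rewrite -nneseries_esumT//.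
rewrite -nneseries_esumT; last by move=> i; apply: nneseries_ge0.
by apply: lee_nneseries => [i _ _|i _]; [exact: nneseries_ge0|exact: (GP i).2].
Qed.

HB.instance Definition _ := isOuterMeasure.Build R V mu
  leb_outer0 leb_outer_ge0 le_leb_outer leb_outer_sigma_subadditive.

(** A hyperplane cuts every box of a cover into two boxes whose volumes add up, so a cover of [X]
    yields covers of both sides with the same total volume. *)
Lemma halfspace_caratheodory (i : 'I_n.+1) (c : R) :
  mu.-caratheodory [set x : V | x ord0 i < c].
Proof.
apply: le_caratheodory_measurable => X.
apply: le_ereal_inf_tmp => _ [a [b [Xab ->]]].
(* The lower piece runs from [a k] to [b' k], the upper one from [a' k] to [b k]. A piece that
   misses its side gets volume 0 from the truncation in [box_vol]. *)
pose a' k : V := \row_j (if j == i then Num.max (a k ord0 j) c else a k ord0 j).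
pose b' k : V := \row_j (if j == i then Num.min (b k ord0 j) c else b k ord0 j).
have vol k : box_vol (a k) (b k) = box_vol (a k) (b' k) + box_vol (a' k) (b k).
  have volD1 (u w : V) : box_vol u w = Num.max 0 (w ord0 i - u ord0 i) *
      \prod_(j < n.+1 | j != i) Num.max 0 (w ord0 j - u ord0 j) by exact: bigD1.
  rewrite !volD1 !mxE eqxx.
  have -> : \prod_(j < n.+1 | j != i) Num.max 0 (b' k ord0 j - a k ord0 j) =
            \prod_(j < n.+1 | j != i) Num.max 0 (b k ord0 j - a k ord0 j).
    by apply: eq_bigr => j /negbTE ji; rewrite !mxE ji.
  have -> : \prod_(j < n.+1 | j != i) Num.max 0 (b k ord0 j - a' k ord0 j) =
            \prod_(j < n.+1 | j != i) Num.max 0 (b k ord0 j - a k ord0 j).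
    by apply: eq_bigr => j /negbTE ji; rewrite !mxE ji.
  rewrite -mulrDl; congr (_ * _).
  move: (a k ord0 i) (b k ord0 i) => u w.
  by case: (leP w c) => wc; case: (leP u c) => uc;
    case: (leP 0 (w - u)) => ?; case: (leP 0 (c - u)) => ?;
    case: (leP 0 (w - c)) => ?; lra.
under eq_eseriesr do rewrite vol EFinD.
rewrite nneseriesD; try by move=> *; rewrite lee_fin box_vol_ge0.
apply: leeD; apply: leb_outer_le_cover => x [Xx xc];
  have [k _ xk] := Xab _ Xx; exists k => // j; rewrite !mxE; case: eqP => [->|_];
  have /andP[h1 h2] := xk j => //; have /andP[h3 h4] := xk i.
- by rewrite h3 lt_min h4.
- by rewrite h4 ge_max h3 leNgt; apply/andP; split => //; apply/negP.
Qed.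

Lemma box_caratheodory (a b : V) : mu.-caratheodory (box a b).
Proof.
pose M := (caratheodory_type mu : measurableType _).
have H i c : measurable ([set x : V | x ord0 i < c] : set M).
  exact: halfspace_caratheodory.
suff : measurable (box a b : set M) by [].
rewrite (_ : box a b = \bigcap_(i in [set: 'I_n.+1])
  (~` [set x : V | x ord0 i < a ord0 i] `&` [set x : V | x ord0 i < b ord0 i])); last first.
  apply/seteqP; split=> [x abx i _|x abx i].
    by have /andP[ai bi] := abx i; split=> //=; apply/negP; rewrite -leNgt.
  by have [/negP + ->] := abx i I; rewrite -leNgt => ->.
apply: fin_bigcap_measurable => // i _.
by apply: measurableI; [apply: measurableC|]; exact: H.
Qed.

Definition rat_box (q : 'rV[rat]_n.+1 * 'rV[rat]_n.+1) : set V :=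
  box (map_mx ratr q.1 : V) (map_mx ratr q.2 : V).

Lemma open_rat_box (U : set V) (x : V) : open U -> U x ->
  exists q, rat_box q x /\ rat_box q `<=` U.
Proof.
rewrite openE => /[apply] /nbhs_ballP[e /= e0 xeU].
have /choice[p pP] i : exists p : rat, x ord0 i - e < ratr p < x ord0 i.
  have /rat_in_itvoo[p] : x ord0 i - e < x ord0 i by rewrite gtrBl.
  by rewrite in_itv/=; exists p.
have /choice[q qP] i : exists q : rat, x ord0 i < ratr q < x ord0 i + e.
  have /rat_in_itvoo[q] : x ord0 i < x ord0 i + e by rewrite ltrDl.
  by rewrite in_itv/=; exists q.
exists (\row_i p i, \row_i q i); split=> [i|y pqy] /=.
  by rewrite !mxE; case/andP: (pP i) => _ /ltW ->; case/andP: (qP i).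
apply: xeU; split=> // i j; rewrite ord1.
have := pqy j; rewrite !mxE /ball/= => /andP[py yq].
case/andP: (pP j) => ep _; case/andP: (qP j) => _ qe.
by rewrite ltr_norml; apply/andP; split; lra.
Qed.

(** An open set is the union of the countably many rational boxes inside it. In the enumeration [F],
    codes that do not decode to such a box stand for the empty set. *)
Lemma open_caratheodory (U : set V) : open U -> mu.-caratheodory U.
Proof.
move=> oU.
pose F k := if unpickle k is Some q then
  if `[< rat_box q `<=` U >] then rat_box q else set0 else set0.
rewrite (_ : U = \bigcup_k F k).
  apply: caratheodory_measurable_bigcup => k; rewrite /F.
  case: unpickle => [q|]; last exact: caratheodory_measurable_set0.
  by case: ifP => _; [exact: box_caratheodory|exact: caratheodory_measurable_set0].
apply/seteqP; split=> [x /(open_rat_box oU)[q [xq qU]]|x [k _]].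
  by exists (pickle q) => //; rewrite /F pickleK; case: asboolP.
by rewrite /F; case: unpickle => // q; case: asboolP => // qU /qU.
Qed.

End LebesgueOuterMeasure.

(** Continuity from below of the measure induced on the Caratheodory sets. *)
Lemma outer_measure_nondecreasing_cvg (R : realType) (T : pointedType)
    (mu : {outer_measure set T -> \bar R}) (U : (set T)^nat) :
  (forall m, mu.-caratheodory (U m)) -> nondecreasing_seq U ->
  mu (U m) @[m --> \oo] --> mu (\bigcup_m U m).
Proof.
move=> mU ndU.
apply: (@nondecreasing_cvg_mu _ _ R
  (mu : {measure set (caratheodory_type mu) -> \bar R})) => //.
exact: caratheodory_measurable_bigcup.
Qed.

(** * Scaling, outer regularity and finite subcovers *)

Section LebesgueOuterMeasureHomothety.
Variables (R : realType) (n : nat).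
Local Notation V := 'rV[R]_n.+1.
Local Notation mu := (@leb_outer R n.+1).

Definition homothet (v : V) (r : R) (S : set V) : set V :=
  [set v + r *: x | x in S].

Lemma homothetP (v : V) (r : R) (S : set V) (x : V) : r != 0 ->
  homothet v r S x <-> S (r^-1 *: (x - v)).
Proof.
move=> r0; split=> [[y Sy <-]|Sx].
  by rewrite addrAC subrr add0r scalerA mulVf// scale1r.
by exists (r^-1 *: (x - v)) => //; rewrite scalerA divff// scale1r addrC subrK.
Qed.

Lemma homothet_comp (v w : V) (r s : R) (S : set V) :
  homothet v r (homothet w s S) = homothet (v + r *: w) (r * s) S.
Proof.
rewrite /homothet image_comp; apply: eq_imagel => x _ /=.
by rewrite scalerDr scalerA addrA.
Qed.

Lemma homothet01 (S : set V) : homothet 0 1 S = S.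
Proof.
rewrite -[RHS]image_id; apply: eq_imagel => x _ /=.
by rewrite add0r scale1r.
Qed.

Lemma box_vol_scale (c : R) (a b a' b' : V) : 0 <= c ->
  (forall i, b' ord0 i - a' ord0 i = c * (b ord0 i - a ord0 i)) ->
  box_vol a' b' = c ^+ n.+1 * box_vol a b.
Proof.
move=> c0 ab; have -> : c ^+ n.+1 = \prod_(i < n.+1) c.
  by rewrite prodr_const card_ord.
rewrite -big_split/=; apply: eq_bigr => i _.
by rewrite ab maxr_pMr// mulr0.
Qed.

Lemma leb_outer_homothet_le (v : V) (r : R) (S : set V) : 0 < r ->
  (mu (homothet v r S) <= (r ^+ n.+1)%:E * mu S)%E.
Proof.
move=> r0; rewrite -lee_pdivrMl ?exprn_gt0//.
apply: le_ereal_inf_tmp => _ [a [b [Sab ->]]].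
rewrite lee_pdivrMl ?exprn_gt0//.
rewrite -nneseriesZl; last by move=> k _; rewrite lee_fin box_vol_ge0.
apply: (le_trans (leb_outer_le_cover (a := fun k => v + r *: a k)
  (b := fun k => v + r *: b k) _)) => [_ [x /Sab[k _ abx] <-]|].
  by exists k => // i; rewrite !mxE lerD2l ltrD2l ler_pM2l ?ltr_pM2l.
under eq_eseriesr => k _.
  rewrite (@box_vol_scale r (a k) (b k)) ?ltW//; last first.
    by move=> i; rewrite !mxE; ring.
  rewrite EFinM.
over.
by [].
Qed.

(** The reverse inequality is the one already proved, applied to the inverse homothety. *)
Lemma leb_outer_homothet (v : V) (r : R) (S : set V) : 0 < r ->
  mu (homothet v r S) = ((r ^+ n.+1)%:E * mu S)%E.
Proof.
move=> r0; apply/eqP; rewrite eq_le leb_outer_homothet_le//=.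
have rV0 : 0 < r^-1 by rewrite invr_gt0.
have := leb_outer_homothet_le (- (r^-1 *: v)) (homothet v r S) rV0.
rewrite homothet_comp addNr mulVf ?gt_eqF// homothet01 exprVn.
by rewrite lee_pdivlMl ?exprn_gt0.
Qed.

Lemma homothet_open (v : V) (r : R) (S : set V) : r != 0 -> open S ->
  open (homothet v r S).
Proof.
move=> r0 oS; rewrite (_ : homothet v r S = (fun x => r^-1 *: (x - v)) @^-1` S).
  apply: open_comp => // x _; exact: (cvgZl_tmp (cvgB cvg_id (cvg_cst v))).
by apply/seteqP; split=> x /(homothetP v S x r0).
Qed.

Lemma coord_le_norm (x : V) (i : 'I_n.+1) : `|x ord0 i| <= `|x|.
Proof.
rewrite [`|x|]mx_normrE.
exact: (le_bigmax _ (fun ij : 'I_1 * 'I_n.+1 => `|x ij.1 ij.2|) (ord0, i)).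
Qed.

Lemma leb_outer_box_le (a b : V) : (mu (box a b) <= (box_vol a b)%:E)%E.
Proof.
apply: (le_trans (leb_outer_le_cover (a := fun k => if k == 0%N then a else 0)
  (b := fun k => if k == 0%N then b else 0) _)); first by move=> x; exists 0%N.
rewrite (nneseriesD1 (n := 0%N))//=; last by move=> k _; rewrite lee_fin box_vol_ge0.
rewrite eseries0 ?adde0// => k _ /negbTE ->.
by rewrite /box_vol big_ord_recl mxE subrr maxxx mul0r.
Qed.

Lemma leb_outer_bounded (S : set V) : bounded_set S -> (mu S < +oo)%E.
Proof.
move=> [M0 [_ SM0]]; pose M := M0 + 1.
have {SM0}SM x : S x -> `|x| <= M by apply: SM0; rewrite ltrDl.
pose a : V := \row_i (- M - 1); pose b : V := \row_i (M + 1).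
apply: (@le_lt_trans _ _ (mu (box a b))); last first.
  by apply: le_lt_trans (leb_outer_box_le _ _) _; exact: ltry.
apply: le_leb_outer => x /SM xM i; rewrite !mxE -/M.
by have := le_trans (coord_le_norm x i) xM; rewrite ler_norml => /andP[? ?];
  apply/andP; split; lra.
Qed.

Lemma expr_near1 (m : nat) (e : R) : 0 < e ->
  exists q : R, [/\ 0 < q, q < 1 & 1 - e < q ^+ m].
Proof.
move=> e0; pose x := Num.min e 1 / m.+2%:R.
(* The witness is [1 - x], by Bernoulli's inequality; dividing by [m.+2] instead of [m] keeps it
   positive and makes the final bound strict. *)
have x0 : 0 < x by rewrite divr_gt0// lt_min e0 ltr01.
have mx : m.+2%:R * x = Num.min e 1 by rewrite mulrC divfK.
have me : Num.min e 1 <= e by rewrite ge_min lexx.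
have m1 : Num.min e 1 <= 1 by rewrite ge_min lexx orbT.
have bernoulli k : (k <= m)%N -> 1 - k%:R * x <= (1 - x) ^+ k.
  elim: k => [|k IHk km]; first by rewrite mul0r subr0.
  rewrite exprS; apply: (@le_trans _ _ ((1 - x) * (1 - k%:R * x))).
    have : 0 <= k%:R :> R by [].
    rewrite -[k.+1%:R]natr1; nra.
  rewrite ler_pM2l ?IHk ?(ltnW km)// subr_gt0.
  have : 0 <= m%:R :> R by [].
  move: mx; rewrite -!natr1; nra.
have m0 : 0 <= m%:R :> R by [].
move: mx; rewrite -!natr1 => mx.
exists (1 - x); split; [nra|nra|].
by apply: lt_le_trans (bernoulli m (leqnn m)); nra.
Qed.

(** Half-open boxes become open when the lower corner is pushed outwards, stretching every side by
    [q^-1]; the upper faces are already excluded. *)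
Lemma leb_outer_open_approx (A : set V) (y : R) : (mu A < y%:E)%E ->
  exists G : set V, [/\ open G, A `<=` G & (mu G < y%:E)%E].
Proof.
move=> /leb_outer_cover_lt[a [b [Aab]]].
have s0 : (0 <= \sum_(0 <= k <oo) (box_vol (a k) (b k))%:E)%E.
  by apply: nneseries_ge0 => k _ _; rewrite lee_fin box_vol_ge0.
case Es : (\sum_(0 <= k <oo) (box_vol (a k) (b k))%:E)%E s0 => [s| |]//.
rewrite lee_fin lte_fin => s0 sy.
have y0 : 0 < y by exact: le_lt_trans sy.
(* This gives [q ^+ n.+1 > s / y], so the stretched boxes still have total volume below [y]. *)
have [|q [q0 q1 qy]] := @expr_near1 n.+1 ((y - s) / y).
  by rewrite divr_gt0// subr_gt0.
pose a' k := b k - q^-1 *: (b k - a k).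
exists (\bigcup_k [set x : V | forall i, a' k ord0 i < x ord0 i < b k ord0 i]).
split.
- apply: bigcup_open => k _; rewrite openE => x /= xab.
  exists (fun _ i => `]a' k ord0 i, b k ord0 i[%classic) => [i j|z zab i].
    rewrite ord1; apply: open_nbhs_nbhs; split; first exact: interval_open.
    by rewrite /= in_itv/=.
  by have := zab ord0 i; rewrite /= in_itv/=.
- move=> x /Aab[k _ xk]; exists k => // i.
  have /andP[ax xb] := xk i; rewrite xb andbT !mxE.
  have : b k ord0 i - a k ord0 i < q^-1 * (b k ord0 i - a k ord0 i).
    by rewrite ltr_pMl ?invf_gt1// subr_gt0 (le_lt_trans ax).
  lra.
- apply: (@le_lt_trans _ _ (\sum_(0 <= k <oo) (box_vol (a' k) (b k))%:E)%E).
    apply: leb_outer_le_cover => x [k _ xk]; exists k => // i.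
    by have /andP[/ltW -> ->] := xk i.
  under eq_eseriesr => k _.
    rewrite (@box_vol_scale q^-1 (a k) (b k)) ?invr_ge0 ?ltW//; last first.
      by move=> i; rewrite !mxE; ring.
    rewrite EFinM.
  over.
  rewrite nneseriesZl; last by move=> k _; rewrite lee_fin box_vol_ge0.
  rewrite Es -EFinM lte_fin exprVn mulrC ltr_pdivrMr ?exprn_gt0//.
  apply: le_lt_trans (_ : s <= y * (1 - (y - s) / y)) _; last by rewrite ltr_pM2l.
  by rewrite mulrBr mulr1 mulrC divfK ?gt_eqF// opprB addrC subrK.
Qed.

(** A Lindelof argument: countably many rational boxes, each inside some [O y], cover [A]. One [y]
    per box gives increasing finite unions of the [O y]; these are open, so continuity from below
    applies to them rather than to [A]. *)
Lemma leb_outer_finite_subcover (A : set V) (O : V -> set V) (x : \bar R) :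
  (forall y, A y -> open (O y) /\ O y y) -> (x < mu A)%E ->
  exists s : seq V, {in s, forall y, A y} /\
    (x < mu (\big[setU/set0]_(y <- s) O y))%E.
Proof.
move=> AO xA.
(* The list [s k] holds one centre for the rational box of code [k], or nothing when that box fits
   in no [O y]. *)
have /choice[s sP] k : exists s : seq V, {in s, forall y, A y} /\
    forall q, unpickle k = Some q -> (exists y, A y /\ rat_box q `<=` O y) ->
      rat_box q `<=` \big[setU/set0]_(y <- s) O y.
  case: (unpickle k) => [q|]; last by exists [::].
  have [[y [Ay yq]]|nq] := pselect (exists y, A y /\ rat_box q `<=` O y).
    by exists [:: y]; split=> [z|_ [<-] _]; rewrite ?big_seq1 // inE => /eqP ->.
  by exists [::]; split=> // _ [<-] /nq.
pose U m := \big[setU/set0]_(y <- flatten [seq s k | k <- iota 0 m]) O y.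
have sA m y : y \in flatten [seq s k | k <- iota 0 m] -> A y.
  by move=> /flatten_mapP[k _]; exact: (sP k).1.
have oU m : open (U m).
  rewrite /U big_seq; apply: big_ind => [||y /sA/AO[]//]; first exact: open0.
  exact: openU.
have AU : A `<=` \bigcup_m U m.
  move=> y Ay; have [oO Oy] := AO _ Ay.
  have [q [qy qO]] := open_rat_box oO Oy.
  exists (pickle q).+1 => //; rewrite /U -[(pickle q).+1]addn1.
  rewrite iotaD map_cat flatten_cat big_cat.
  right; rewrite /= cats0; apply: (sP _).2 qy; last by exists y.
  by rewrite add0n pickleK.
have cU : mu (U m) @[m --> \oo] --> mu (\bigcup_m U m).
  apply: outer_measure_nondecreasing_cvg.
  - by move=> m; exact: open_caratheodory.
  - apply/nondecreasing_seqP => m; rewrite /U -[m.+1]addn1 iotaD map_cat flatten_cat.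
    by rewrite big_cat; apply/subsetPset; exact: subsetUl.
have [m xm] : exists m, (x < mu (U m))%E.
  apply: contrapT => /forallNP nx.
  have : (mu (\bigcup_m U m) <= x)%E.
    rewrite -(cvg_lim _ cU)//; apply: lime_le; first by apply/cvg_ex; eexists; exact: cU.
    by apply: nearW => m; rewrite leNgt; apply/negP/nx.
  by rewrite leNgt (lt_le_trans xA)//; exact: le_leb_outer.
by exists (flatten [seq s k | k <- iota 0 m]); split => // y /sA.
Qed.

End LebesgueOuterMeasureHomothety.

(** * Convexity and engulfing by translates *)

Lemma convex_setP (R : realType) (M : lmodType R) (S : set M) (x y : M) (t : R) :
  @convex_set R M S -> 0 <= t <= 1 -> S x -> S y -> S (t *: x + (1 - t) *: y).
Proof.
move=> cS /andP[t0 t1] Sx Sy.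
have := cS x y (Itv01 t0 t1); rewrite !inE; exact.
Qed.

Lemma convex_average (R : realType) (M : lmodType R) (S : set M) (k : nat)
    (f : 'I_k.+1 -> M) : @convex_set R M S -> (forall i, S (f i)) ->
  S (k.+1%:R^-1 *: \sum_i f i).
Proof.
move=> cS; elim: k f => [|k IHk] f Sf.
  by rewrite big_ord_recl big_ord0 addr0 invr1 scale1r.
have k0 : 0 <= k.+1%:R :> R by [].
have k1 : k.+2%:R != 0 :> R by rewrite pnatr_eq0.
have kk : k.+1%:R != 0 :> R by rewrite pnatr_eq0.
rewrite big_ord_recr/=; set s := \sum_(i < k.+1) _.
have -> : k.+2%:R^-1 *: (s + f ord_max) =
    (1 - k.+2%:R^-1) *: (k.+1%:R^-1 *: s) + (1 - (1 - k.+2%:R^-1)) *: f ord_max.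
  rewrite scalerDr scalerA subKr; congr (_ *: _ + _).
  move: k1; rewrite -[k.+2%:R]natr1; move: k.+1%:R kk => K K0 K1.
  by field; rewrite K0 K1.
apply: convex_setP => //; last exact: IHk.
rewrite subr_ge0 invf_le1 ?ltr0n// ler1n/= lerBlDr lerDl.
by rewrite invr_ge0.
Qed.

Section Engulfing.
Variables (R : realType) (n : nat).
Local Notation V := 'rV[R]_n.+1.
Implicit Types A : 'M[R]_n.+1.

Definition replace_row A (i : 'I_n.+1) (x : V) : 'M[R]_n.+1 :=
  \matrix_(k, j) if k == i then x ord0 j else A k j.

(** Cramer's rule for row vectors, from the Laplace expansion along row [i]. *)
Lemma cramer_row A (x : V) (i : 'I_n.+1) : \det A != 0 ->
  (x *m invmx A) ord0 i = \det (replace_row A i x) / \det A.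
Proof.
move=> dA; rewrite /invmx unitmxE unitfE dA mxE.
rewrite (expand_det_row (replace_row A i x) i) mulr_suml.
apply: eq_bigr => j _; rewrite !mxE eqxx [_^-1 * _]mulrC mulrA; congr (_ * _ / _).
rewrite /cofactor; congr (_ * \det _).
by apply/matrixP => k l; rewrite !mxE eq_sym (negbTE (neq_lift _ _)).
Qed.

(** A crude bound from the Leibniz formula; it makes the supremum of determinants over a bounded set
    finite. *)
Lemma det_le A (c : R) : (forall i j, `|A i j| <= c) ->
  `|\det A| <= \sum_(s : 'S_n.+1) c ^+ n.+1.
Proof.
move=> Ac; apply: le_trans (ler_norm_sum _ _ _) _; apply: ler_sum => s _.
rewrite normrM normrX normrN1 expr1n mul1r normr_prod.
rewrite -[X in c ^+ X]card_ord -prodr_const.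
by apply: ler_prod => i _; rewrite normr_ge0 Ac.
Qed.

(* The rows of [A] span a simplex of nearly maximal volume in [T]; by Cramer's
   rule all of [T] then has coordinates at most [2] with respect to these rows. *)
Lemma exists_large_simplex (T : set V) : open T -> bounded_set T -> T 0 ->
  exists A, [/\ \det A != 0, forall i, T (row i A) &
    forall x, T x -> forall i, `|(x *m invmx A) ord0 i| <= 2].
Proof.
move=> oT [c0 [_ Tc0]] T0; pose c := c0 + 1.
have {Tc0}Tc x : T x -> `|x| <= c by apply: Tc0; rewrite ltrDl.
pose D := [set `|\det A| | A in [set A | forall i, T (row i A)]].
have supD : has_sup D.
  split; first by exists `|\det (0 : 'M[R]_n.+1)|, 0 => // i; rewrite row0.
  exists (\sum_(s : 'S_n.+1) c ^+ n.+1) => _ [A TA <-].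
  apply: det_le => i j; have := Tc _ (TA i).
  by apply: le_trans; have := coord_le_norm (row i A) j; rewrite mxE.
(* Small multiples of the unit vectors lie in [T], so the supremum of the determinants is
   positive. *)
have [e e0 eT] : exists2 e : R, 0 < e & forall i, T (e *: delta_mx ord0 i).
  move: oT; rewrite openE => /(_ _ T0)/nbhs_ballP[e /= e0 eT].
  exists (e / 2); first by rewrite divr_gt0.
  move=> i; apply: eT; split=> // a b; rewrite !mxE /ball/= sub0r normrN normrM.
  rewrite gtr0_norm ?divr_gt0//.
  by case: (_ && _); rewrite ?normr1 ?normr0; lra.
have D0 : 0 < sup D.
  apply: (@lt_le_trans _ _ `|\det (e%:M : 'M[R]_n.+1)|).
    by rewrite det_scalar normr_gt0 expf_neq0 ?gt_eqF.
  apply: (ub_le_sup supD.2); exists e%:M => //= i.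
  suff -> : row i e%:M = e *: delta_mx ord0 i by [].
  apply/matrixP => a b; rewrite !mxE ord1 eqxx/=.
  by rewrite eq_sym mulr_natr.
have D2 : 0 < sup D / 2 by rewrite divr_gt0.
(* The supremum need not be attained, so [A] only reaches more than half of it; hence the bound 2 on
   the coordinates. *)
have [_ [A TA <-] DA] := sup_adherent D2 supD.
have dA : \det A != 0 by rewrite -normr_gt0; lra.
exists A; split=> // x Tx i; rewrite cramer_row// normrM normfV.
rewrite ler_pdivrMr ?normr_gt0//.
apply: (@le_trans _ _ (sup D)); last lra.
apply: (ub_le_sup supD.2); exists (replace_row A i x) => //= k.
have [->|ki] := eqVneq k i.
  suff -> : row i (replace_row A i x) = x by [].
  by apply/rowP => j; rewrite !mxE eqxx.
suff -> : row k (replace_row A i x) = row k A by [].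
by apply/rowP => j; rewrite !mxE (negbTE ki).
Qed.

(** Nodes of mesh [1 / n.+1] in the cube of coordinates between -6 and 6: each axis has [12 * n.+1]
    steps, hence one more node. *)
Definition grid := {ffun 'I_n.+1 -> 'I_(12 * n.+1).+1}.

(** Relative to [p0], the point [x + y - z] is a signed sum of three points of [T], so its
    coordinates in the simplex basis are at most 6 in absolute value. Rounding them down to the grid
    leaves a remainder in [T]. *)
Lemma engulfing (S : set V) : open S -> bounded_set S -> @convex_set R V S ->
  S !=set0 ->
  exists w : grid -> V, forall x y z, S x -> S y -> S z ->
    exists k, S (x + y - z - w k).
Proof.
move=> oS bS cS [p0 Sp0].
pose T := homothet (- p0) 1 S.
have TP x : T x <-> S (p0 + x).
  by rewrite /T homothetP ?oner_eq0// invr1 scale1r opprK addrC.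
have T0 : T 0 by apply/TP; rewrite addr0.
have oT : open T by apply: homothet_open => //; rewrite oner_eq0.
have bT : bounded_set T.
  move: bS => [c0 [_ Sc0]]; pose c := c0 + 1.
  have {Sc0}Sc x : S x -> `|x| <= c by apply: Sc0; rewrite ltrDl.
  exists (c + `|p0|); split=> [|M cM x /TP/Sc xc]; first exact: num_real.
  apply: le_trans (ltW cM); rewrite -[x](addKr p0) addrC.
  by apply: le_trans (ler_normB _ _) _; rewrite lerD2r.
have [A [dA TA AT]] := exists_large_simplex oT bT T0.
pose m : R := n.+1%:R.
have m0 : 0 < m by rewrite ltr0n.
exists (fun k : grid => (\row_i ((k i)%:R / m - 6)) *m A) => x y z Sx Sy Sz.
pose a := (x + y - z - p0) *m invmx A.
have aA : a *m A = x + y - z - p0.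
  by rewrite -mulmxA mulVmx ?mulmx1// unitmxE unitfE.
have a6 i : `|a ord0 i| <= 6.
  have /AT/(_ i) hx : T (x - p0) by apply/TP; rewrite addrC subrK.
  have /AT/(_ i) hy : T (y - p0) by apply/TP; rewrite addrC subrK.
  have /AT/(_ i) hz : T (z - p0) by apply/TP; rewrite addrC subrK.
  have -> : a = (x - p0) *m invmx A + (y - p0) *m invmx A - (z - p0) *m invmx A.
    rewrite -mulmxDl -mulmxBl; congr (_ *m _).
    by apply/rowP => j; rewrite !mxE; ring.
  move: ((x - p0) *m _) ((y - p0) *m _) ((z - p0) *m _) hx hy hz => u v w; rewrite !mxE.
  by rewrite !ler_norml => /andP[? ?] /andP[? ?] /andP[? ?];
    apply/andP; split; lra.
have /choice[k kP] i : exists k : 'I_(12 * n.+1).+1,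
    k%:R <= m * (a ord0 i + 6) < k%:R + 1.
  have := a6 i; rewrite ler_norml => /andP[a1 a2].
  have b0 : 0 <= m * (a ord0 i + 6) by apply: mulr_ge0; [exact: ltW|lra].
  have /andP[h1 h2] := truncn_itv b0.
  have kb : (Num.truncn (m * (a ord0 i + 6)) < (12 * n.+1).+1)%N.
    rewrite ltnS -(ler_nat R) natrM -/m; apply: le_trans h1 _.
    by rewrite mulrC ler_pM2r//; lra.
  by exists (Ordinal kb); rewrite /= h1/= natr1.
exists (finfun k).
have -> : x + y - z - (\row_i ((finfun k i)%:R / m - 6)) *m A =
    p0 + (\row_i (a ord0 i - ((k i)%:R / m - 6))) *m A.
  have -> : \row_i (a ord0 i - ((k i)%:R / m - 6)) =
      a - \row_i ((finfun k i)%:R / m - 6).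
    by apply/rowP => i; rewrite !mxE ffunE.
  by rewrite mulmxBl aA addrA [p0 + _]addrC subrK.
apply/TP.
have cT : @convex_set R V T.
  move=> u v t; rewrite !inE => /TP Su /TP Sv; apply/TP.
  have /convex_setP/(_ Su Sv) : 0 <= t%:num <= 1 by rewrite ge0 le1.
  by rewrite !scalerDr addrACA -scalerDl [t%:num + _]addrC subrK scale1r; exact.
rewrite mulmx_sum_row.
(* The remainder is the average of [n.+1] points, each on the segment from 0 to a row of [A], hence
   each in [T]. *)
have -> : \sum_i (\row_i (a ord0 i - ((k i)%:R / m - 6))) ord0 i *: row i A =
    m^-1 *: \sum_i (m * (a ord0 i + 6) - (k i)%:R) *: row i A.
  rewrite scaler_sumr; apply: eq_bigr => i _; rewrite mxE scalerA.
  by congr (_ *: _); field; rewrite gt_eqF.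
apply: convex_average => // i; have /andP[k1 k2] := kP i.
rewrite -[X in T X]addr0 -(scaler0 _ (1 - (m * (a ord0 i + 6) - (k i)%:R))).
by apply: convex_setP => //; apply/andP; split; lra.
Qed.

End Engulfing.

(** * Vitali covering by homothetic copies of a convex set *)

Lemma outer_measure_big_seq (R : realType) (T I : Type)
    (mu : {outer_measure set T -> \bar R}) (s : seq I) (F : I -> set T) :
  (mu (\big[setU/set0]_(i <- s) F i) <= \sum_(i <- s) mu (F i))%E.
Proof.
elim: s => [|i s IHs]; first by rewrite !big_nil outer_measure0.
rewrite !big_cons; apply: le_trans (outer_measureU2 _ _ _) _.
exact: leeD2l.
Qed.

Section Covering.
Variables (R : realType) (n : nat).
Local Notation V := 'rV[R]_n.+1.
Local Notation mu := (@leb_outer R n.+1).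
Implicit Types (S : set V) (p q : V * R).

Definition copy S p : set V := homothet p.1 p.2 S.

Definition disjoint_copies S : rel (V * R) :=
  fun p q => `[< copy S p `&` copy S q = set0 >].

Definition copies S (s : seq (V * R)) : set V := \big[setU/set0]_(p <- s) copy S p.

Lemma copies_cons S p s : copies S (p :: s) = copy S p `|` copies S s.
Proof. exact: big_cons. Qed.

Lemma copiesP S (s : seq (V * R)) x : copies S s x <-> exists2 p, p \in s & copy S p x.
Proof.
elim: s => [|q s IHs]; first by rewrite /copies big_nil; split=> // -[].
rewrite copies_cons; split=> [[qx|/IHs[p ps px]]|[p]].
- by exists q; rewrite ?mem_head.
- by exists p; rewrite // inE ps orbT.
- by rewrite inE => /orP[/eqP ->|ps px]; [left|right; apply/IHs; exists p].
Qed.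

Lemma copy_open S p : 0 < p.2 -> open S -> open (copy S p).
Proof. by move=> p0; apply: homothet_open; rewrite gt_eqF. Qed.

Lemma leb_outer_copy S p : 0 < p.2 ->
  mu (copy S p) = ((p.2 ^+ n.+1)%:E * mu S)%E.
Proof. exact: leb_outer_homothet. Qed.

Lemma copies_open S (s : seq (V * R)) : {in s, forall p, 0 < p.2} -> open S ->
  open (copies S s).
Proof.
move=> s0 oS; rewrite /copies big_seq.
apply: big_ind => [||p /s0 p0]; [exact: open0|exact: openU|exact: copy_open].
Qed.

(** Each copy is open, hence Caratheodory, and can be split off in turn from an arbitrary [X]. *)
Lemma copies_additive S (s : seq (V * R)) (X : set V) :
  {in s, forall p, 0 < p.2} -> open S -> pairwise (disjoint_copies S) s ->
  mu (X `&` copies S s) = (\sum_(p <- s) mu (X `&` copy S p))%E.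
Proof.
move=> + oS; elim: s => [|p s IHs] s0 /=.
  by rewrite /copies !big_nil setI0 outer_measure0.
move=> /andP[ps spw]; rewrite big_cons -IHs//; last first.
  by move=> q qs; apply: s0; rewrite inE qs orbT.
have mp : mu.-caratheodory (copy S p).
  by apply: open_caratheodory; apply: copy_open => //; apply: s0; rewrite mem_head.
rewrite (mp (X `&` _)) copies_cons -!setIA; congr (mu (_ `&` _) + mu (_ `&` _))%E.
  by rewrite setIC setIUr setIid; apply/setUidPl; exact: subIsetl.
rewrite setIUl setICr set0U; apply/setIidPl => x /copiesP[q qs qx] px.
have /asboolP pq := allP ps _ qs.
by have : (copy S p `&` copy S q) x by []; rewrite pq.
Qed.

(** The number of translates in [engulfing]; it depends on the dimension alone. *)
Definition vitali_const : R := #|{: grid n}|%:R.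

Lemma vitali_const_gt0 : 0 < vitali_const.
Proof. by rewrite ltr0n card_ffun !card_ord expn_gt0. Qed.

(** Let the copies, of ratios [r >= s], meet at the images of [x] and [z]. In the frame of the
    larger one, the image of [y] under the smaller is [x + y' - z], where
    [y' = (s / r) y + (1 - s / r) z] is in [S] by convexity. *)
Lemma copy_engulfing S : open S -> bounded_set S -> @convex_set R V S ->
  S !=set0 ->
  exists w : grid n -> V, forall p q, 0 < q.2 <= p.2 ->
    copy S p `&` copy S q !=set0 ->
    copy S q `<=` \big[setU/set0]_(k <- enum {: grid n}) copy S (p.1 + p.2 *: w k, p.2).
Proof.
move=> oS bS cS S0; have [w wP] := engulfing oS bS cS S0.
exists w => -[v r] [u s] /= /andP[s0 sr] [_ [[x Sx <-] [z Sz xz]]] _ [y Sy <-].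
have r0 : 0 < r by exact: lt_le_trans sr.
have Sy' : S ((s / r) *: y + (1 - s / r) *: z).
  by apply: convex_setP => //; rewrite ler_pdivrMr// mul1r sr andbT divr_ge0// ltW.
have [k Sk] := wP _ _ _ Sx Sy' Sz.
rewrite -bigcup_seq; exists k; first by rewrite /= mem_enum.
apply/homothetP; rewrite ?gt_eqF//=.
suff <- : x + ((s / r) *: y + (1 - s / r) *: z) - z - w k =
   r^-1 *: (u + s *: y - (v + r *: w k)) by [].
apply/rowP => i; move/rowP/(_ i): xz; rewrite !mxE => xz.
have -> : u ord0 i = v ord0 i + r * x ord0 i - s * z ord0 i by rewrite -xz addrK.
by field; rewrite gt_eqF.
Qed.

(** Greedy selection: keep a copy of largest ratio, discard the copies that meet it, and recurse.
    The discarded ones are engulfed by [vitali_const] translates of the one kept. *)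
Lemma finite_vitali S (s : seq (V * R)) :
  open S -> bounded_set S -> @convex_set R V S -> S !=set0 ->
  {in s, forall p, 0 < p.2} ->
  exists t, [/\ {subset t <= s}, pairwise (disjoint_copies S) t &
    (mu (copies S s) <= vitali_const%:E * \sum_(p <- t) mu (copy S p))%E].
Proof.
move=> oS bS cS S0; have [w wP] := copy_engulfing oS bS cS S0.
have [x0 Sx0] := S0.
have [k] := ubnP (size s); elim: k s => // k IHk [|p1 s1].
  by exists [::]; split => //; rewrite /copies !big_nil outer_measure0 mule0.
set s := p1 :: s1; rewrite ltnS => sk s0.
have [p ps pmax] : exists2 p, p \in s & {in s, forall q, q.2 <= p.2}.
  rewrite /s; elim: s1 p1 {s sk s0} => [|q s IHs] p1.
    by exists p1; rewrite ?mem_head// => q; rewrite inE => /eqP ->.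
  have [p ps pmax] := IHs q.
  have [p1p|/ltW pp1] := leP p1.2 p.2.
    exists p; first by rewrite inE ps orbT.
    by move=> z; rewrite inE => /orP[/eqP ->//|/pmax].
  exists p1; first by rewrite mem_head.
  by move=> z; rewrite inE => /orP[/eqP ->//|/pmax/le_trans]; exact.
have p0 := s0 _ ps.
pose rest := [seq q <- s | disjoint_copies S p q].
have rests : {subset rest <= s} by move=> q; rewrite mem_filter => /andP[].
have [||t [trest tpw tmu]] := IHk rest.
(* [rest] is shorter than [s], because the nonempty copy [p] meets itself. *)
- apply: leq_trans sk; rewrite size_filter -(count_predC (disjoint_copies S p) s).
  rewrite -[X in (X < _)%N]addn0 ltn_add2l -has_count; apply/hasP; exists p => //=.
  apply/asboolPn => /seteqP[/(_ (p.1 + p.2 *: x0)) pp _]; apply: pp.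
  by split; exists x0.
- by move=> q /rests/s0.
exists (p :: t); split.
- by move=> q; rewrite inE => /orP[/eqP ->//|/trest/rests].
- rewrite /= tpw andbT; apply/allP => q /trest.
  by rewrite mem_filter => /andP[].
rewrite big_cons muleDr ?ge0_adde_def ?inE ?sume_ge0 ?leb_outer_ge0//; last first.
  by move=> *; exact: leb_outer_ge0.
pose E := \big[setU/set0]_(k <- enum {: grid n}) copy S (p.1 + p.2 *: w k, p.2).
apply: (@le_trans _ _ (mu (E `|` copies S rest))).
  apply: le_leb_outer => x /copiesP[q qs qx].
  have [pq|pq] := boolP (disjoint_copies S p q).
    by right; apply/copiesP; exists q; rewrite // mem_filter pq.
  left; apply: wP qx; first by rewrite s0//= pmax.
  by apply/set0P/eqP; move: pq => /asboolPn.
apply: le_trans (outer_measureU2 _ _ _) _; apply: leeD => //.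
apply: le_trans (outer_measure_big_seq _ _ _) _.
under eq_bigr => i _ do rewrite /= leb_outer_copy//.
rewrite /= big_const_seq count_predT -cardE.
rewrite leb_outer_copy// /vitali_const.
elim: #|_| => [|j IHj]; first by rewrite mul0e.
rewrite iterS -nat1r EFinD ge0_muleDl ?lee_fin ?ler01 ?ler0n// mul1e leeD2l//.
Qed.

(** Finitely many copies already cover more than half of the measure of [A], which costs the factor
    2 over [finite_vitali]. A null [A] is set apart, since half of its measure is not strictly
    smaller. *)
Lemma vitali_covering S (A : set V) (h : V -> V * R) :
  open S -> bounded_set S -> @convex_set R V S -> S !=set0 ->
  (mu A < +oo)%E -> (forall y, A y -> 0 < (h y).2 /\ copy S (h y) y) ->
  exists s : seq (V * R), [/\ forall p, p \in s -> exists2 y, A y & p = h y,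
    pairwise (disjoint_copies S) s &
    (mu A <= (2 * vitali_const)%:E * \sum_(p <- s) mu (copy S p))%E].
Proof.
move=> oS bS cS S0 Afin Ah.
have [->|A0] := eqVneq (mu A) 0%E.
  by exists [::]; split=> //; rewrite big_nil mule0.
have Apos : (0 < mu A)%E by rewrite lt_def A0 leb_outer_ge0.
have Afn : mu A \is a fin_num by rewrite ge0_fin_numE ?leb_outer_ge0.
have half : ((2^-1)%:E * mu A < mu A)%E.
  rewrite -[X in (_ < X)%E]fineK// -[X in (_ * X)%E]fineK// -EFinM lte_fin.
  have : 0 < fine (mu A) by rewrite fine_gt0// Apos Afin.
  lra.
have [y Ay|s [sA sgt]] := leb_outer_finite_subcover (O := fun y => copy S (h y)) _ half.
  by have [h0 hy] := Ah _ Ay; split=> //; exact: copy_open.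
have hs0 : {in [seq h y | y <- s], forall p, 0 < p.2}.
  by move=> _ /mapP[y /sA Ay ->]; have [] := Ah _ Ay.
have [t [ts tpw tmu]] := finite_vitali oS bS cS S0 hs0.
exists t; split=> // [p /ts/mapP[y /sA Ay ->]|]; first by exists y.
rewrite EFinM -muleA -lee_pdivrMl//.
apply: le_trans tmu; rewrite /copies big_map; exact: ltW.
Qed.

End Covering.

(** * Density along shrinking copies and the gain of measure *)

Section Halo.
Variables (R : realType) (n : nat).
Local Notation V := 'rV[R]_n.+1.
Local Notation mu := (@leb_outer R n.+1).
Implicit Types (S E F G : set V) (p : V * R).

(** A substitute for the Lebesgue density theorem. If [N] had measure [a > 0], disjoint sparse
    copies in an open [G] around [N] would have a union [U] of measure at least [a / K]. Since [N]
    fills at most a proportion [b] of [U], [G] would exceed [N] by [(1 - b) * a / K], against the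
    choice of [G]. *)
Lemma null_of_sparse_copies S N E (b : R) :
  open S -> bounded_set S -> @convex_set R V S -> S !=set0 ->
  N `<=` E -> (mu N < +oo)%E -> b < 1 ->
  (forall G y, open G -> G y -> N y -> exists p, [/\ 0 < p.2, copy S p y,
    copy S p `<=` G & (mu (E `&` copy S p) <= b%:E * mu (copy S p))%E]) ->
  mu N = 0%E.
Proof.
move=> oS bS cS S0 NE Nfin b1 sparse; apply: contrapT => N0.
have K0 : 0 < 2 * vitali_const R n by rewrite mulr_gt0 ?vitali_const_gt0.
move: (2 * _) K0 (vitali_covering (R := R) (n := n)) => K K0 vitali.
have {N0} : (0 < mu N)%E by rewrite lt_def leb_outer_ge0 andbT; exact/eqP.
move: Nfin; case Na : (mu N) => [a| |]// _; rewrite lte_fin => a0.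
have [|G [oG NG Ge]] := @leb_outer_open_approx _ _ N (a + (1 - b) * a / K).
  by rewrite Na lte_fin ltrDl divr_gt0// mulr_gt0// subr_gt0.
have /choice[h hP] y : exists p, N y -> [/\ 0 < p.2, copy S p y,
    copy S p `<=` G & (mu (E `&` copy S p) <= b%:E * mu (copy S p))%E].
  have [Ny|] := pselect (N y); last by exists (0, 0).
  by have [p pP] := sparse _ _ oG (NG _ Ny) Ny; exists p.
have [||s [sN spw sN_le]] := vitali S N h oS bS cS S0.
- by rewrite Na ltry.
- by move=> y /hP[].
have s0 : {in s, forall p, 0 < p.2} by move=> p /sN[y /hP[? _ _ _] ->].
pose U := copies S s.
have mU : mu.-caratheodory U by apply/open_caratheodory/copies_open.
have UG : U `<=` G by move=> x /copiesP[p /sN[y /hP[_ _ + _] ->]]; exact.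
have muU : mu U = (\sum_(p <- s) mu (copy S p))%E.
  rewrite -[U]setTI copies_additive//.
  by apply: eq_bigr => p _; rewrite setTI.
have muNU : (mu (N `&` U) <= b%:E * mu U)%E.
  apply: (@le_trans _ _ (mu (E `&` U))).
    by apply: le_leb_outer; exact: setSI.
  rewrite copies_additive// muU ge0_sume_distrr; last by move=> *; exact: leb_outer_ge0.
  by rewrite big_seq [leRHS]big_seq; apply: lee_sum => p /sN[y /hP[_ _ _ +] ->].
have muNUC : (mu (N `&` ~` U) <= mu (G `&` ~` U))%E.
  by apply: le_leb_outer; exact: setSI.
move: Ge (mU N) sN_le muNU muNUC; rewrite (mU G) -muU (setIidr UG) Na.
have := leb_outer_ge0 U; have := leb_outer_ge0 (G `&` ~` U).
have := leb_outer_ge0 (N `&` U); have := leb_outer_ge0 (N `&` ~` U).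
case: (mu (N `&` U)) => [x| |]//; case: (mu (N `&` ~` U)) => [z| |]//.
case: (mu (G `&` ~` U)) => [d| |]//; case: (mu U) => [u| |]//.
rewrite -!EFinM -!EFinD !lee_fin lte_fin => _ _ _ _ Ge [axz] aKu xbu zd.
have : (1 - b) * u < (1 - b) * a / K by nra.
rewrite -mulrA ltr_pM2l ?subr_gt0// ltr_pdivlMr// mulrC; lra.
Qed.

Lemma dense_copies_gain S E F (d : R) :
  open S -> bounded_set S -> @convex_set R V S -> S !=set0 ->
  leb_measurable E -> 0 < d -> d < 1 ->
  (mu (E `&` S) <= (1 - d)%:E * mu S)%E ->
  (forall p, 0 < p.2 -> ((1 - 2 * d)%:E * mu (copy S p) < mu (E `&` copy S p))%E ->
    copy S p `<=` F) ->
  ((1 + d / (2 * vitali_const R n))%:E * mu (E `&` S) <= mu (F `&` S))%E.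
Proof.
move=> oS bS cS S0 mE d0 d1 ES dense.
have Sfin : (mu S < +oo)%E by exact: leb_outer_bounded.
(* One shrinking step multiplies volume by [q ^+ n.+1 > 1 - d]. The pair [c y i] encodes the
   homothety of centre [y] and ratio [q ^+ i]. *)
have [q [q0 q1 qd]] := @expr_near1 _ n.+1 _ d0.
pose c y i : V * R := (y - q ^+ i *: y, q ^+ i).
have c0 y i : 0 < (c y i).2 by rewrite exprn_gt0.
have cy y i : S y -> copy S (c y i) y by exists y => //; rewrite /= subrK.
have cS1 y i : S y -> copy S (c y i.+1) `<=` copy S (c y i).
  move=> Sy _ [x Sx <-]; exists (q *: x + (1 - q) *: y).
    by apply: convex_setP => //; rewrite !ltW.
  by apply/rowP => j; rewrite /= !mxE exprS; ring.
have cy0 y : copy S (c y 0%N) = S by rewrite /copy/= expr0 scale1r subrr homothet01.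
have cSS y i : S y -> copy S (c y i) `<=` S.
  move=> Sy; elim: i => [|i IHi]; first by rewrite cy0.
  by apply: subset_trans IHi; exact: cS1.
pose good y i := ((1 - d)%:E * mu (copy S (c y i)) < mu (E `&` copy S (c y i)))%E.
pose N := [set y | (E `&` S) y /\ forall i, ~ good y i].
have N0 : mu N = 0%E.
  apply: (@null_of_sparse_copies S N E (1 - d)) => //.
  - by move=> y [[]].
  - by apply: le_lt_trans Sfin; apply: le_leb_outer => y [[]].
  - by rewrite gtrBl.
  move=> G y oG Gy [[Ey Sy] bad].
  have [i iG] : exists i, copy S (c y i) `<=` G.
    move: oG; rewrite openE => /(_ _ Gy)/nbhs_ballP[e /= e0 eG].
    have [M0 [_ SM0]] := bS; pose M := Num.max 1 (M0 + 1).
    have {SM0}SM x : S x -> `|x| <= M by apply: SM0; rewrite lt_max ltrDl ltr01 orbT.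
    have M1 : 0 < M by rewrite lt_max ltr01.
    have /cvgrPdist_lt/(_ (e / (2 * M))) : GRing.exp q @ \oo --> (0 : R).
      by apply: cvg_expr; rewrite gtr0_norm.
    rewrite divr_gt0 ?mulr_gt0// => /(_ isT)[i _ /(_ i (leqnn i))].
    rewrite /= sub0r normrN gtr0_norm ?exprn_gt0// ltr_pdivlMr ?mulr_gt0// => qe.
    exists i => _ [x Sx <-]; apply: eG; rewrite -ball_normE /ball_/=.
    rewrite -addrA opprD addNKr opprD opprK -scalerBr normrZ gtr0_norm ?exprn_gt0//.
    apply: le_lt_trans qe; rewrite ler_pM2l ?exprn_gt0//.
    by apply: le_trans (ler_normB _ _) _; rewrite mulr_natl mulr2n lerD// SM.
  exists (c y i); split=> //; first exact: cy.
  by rewrite leNgt; exact/negP/bad.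
pose A := (E `&` S) `\` N.
have muA : (mu (E `&` S) <= mu A)%E.
  rewrite -[leRHS]adde0 -N0; apply: le_trans (outer_measureU2 _ _ _) => /=.
  by apply: le_leb_outer => y ESy; have [|] := pselect (N y); [right|left].
have /choice[h hP] y : exists p, A y -> [/\ 0 < p.2, copy S p y, copy S p `<=` S,
    copy S p `<=` F & (mu (E `&` copy S p) <= (1 - d)%:E * mu (copy S p))%E].
  have [[[Ey Sy] Ny]|] := pselect (A y); last by exists (0, 0).
  have exg : exists i, `[< good y i >].
    apply: contrapT => ng; apply: Ny; split=> // i gi; apply: ng.
    by exists i; exact/asboolP.
  (* The first good scale is not 0, where the copy is [S] itself; its predecessor [i] is therefore a
     bad scale. *)
  have [[|i] /asboolP gi imin] := ex_minnP exg.
    by move: gi; rewrite /good cy0 ltNge ES.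
  have bad : ~ good y i.
    by move=> /asboolP /imin; rewrite ltnn.
  exists (c y i) => _; split=> //; [exact: cy|exact: cSS| |].
    apply: dense => //.
    (* The density at scale [i] exceeds [(1 - d) * q ^+ n.+1], which is at least [(1 - d) ^+ 2],
       hence at least [1 - 2 * d]. *)
    have sub : (mu (E `&` copy S (c y i.+1)) <= mu (E `&` copy S (c y i)))%E.
      by apply: le_leb_outer; apply: setIS; exact: cS1.
    apply: le_lt_trans (lt_le_trans gi sub).
    rewrite !leb_outer_copy// !muleA -!EFinM lee_wpmul2r ?leb_outer_ge0// lee_fin.
    rewrite /= [q ^+ i.+1]exprS exprMn mulrA ler_pM2r ?exprn_gt0//.
    nra.
  by rewrite leNgt; exact/negP.
have K0 : 0 < 2 * vitali_const R n by rewrite mulr_gt0 ?vitali_const_gt0.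
move: (2 * _) K0 (vitali_covering (R := R) (n := n)) => K K0 vitali.
have Afin : (mu A < +oo)%E by apply: le_lt_trans Sfin; apply: le_leb_outer => y [[]].
have [||s [sA spw sA_le]] := vitali S A h oS bS cS S0 => //.
  by move=> y /hP[].
have s0 : {in s, forall p, 0 < p.2} by move=> p /sA[y /hP[? _ _ _ _] ->].
(* Measurability of [E] turns density at most [1 - d] into a missing proportion at least [d], summed
   over disjoint copies. *)
have gain : (d%:E * \sum_(p <- s) mu (copy S p) <= mu (~` E `&` copies S s))%E.
  rewrite copies_additive// ge0_sume_distrr; last by move=> *; exact: leb_outer_ge0.
  rewrite big_seq [leRHS]big_seq; apply: lee_sum => p /sA[y /hP[_ _ pS _ pE] ->].
  move: pE; rewrite (mE (copy S (h y))) ![copy _ _ `&` _]setIC.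
  have : (mu (copy S (h y)) < +oo)%E by apply: le_lt_trans Sfin; exact: le_leb_outer.
  rewrite (mE (copy S (h y))) ![copy _ _ `&` _]setIC.
  have := leb_outer_ge0 (E `&` copy S (h y)).
  have := leb_outer_ge0 (~` E `&` copy S (h y)).
  case: (mu (E `&` _)) => [u| |]//; case: (mu (~` E `&` _)) => [v| |]//.
  by rewrite -!EFinD -!EFinM !lee_fin; lra.
(* Split along [E]: the part inside contains [A], the part outside contains what the copies miss of
   [E]. *)
rewrite (mE (F `&` S)).
have AF : (mu A <= mu (F `&` S `&` E))%E.
  by apply: le_leb_outer => y Ay; have [_ py _ pF _] := hP _ Ay; case: Ay => -[Ey Sy] _;
    split=> //; split=> //; exact: pF.
have sF : (mu (~` E `&` copies S s) <= mu (F `&` S `&` ~` E))%E.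
  apply: le_leb_outer => x [Ex /copiesP[p /sA[y /hP[_ _ pS pF _] ->] px]].
  by split=> //; split; [exact: pF|exact: pS].
apply: le_trans (leeD AF (le_trans gain sF)).
have dK0 : 0 <= d / K by rewrite divr_ge0 ?ltW.
rewrite EFinD ge0_muleDl ?lee_fin ?ler01 ?dK0// mul1e; apply: leeD => //.
rewrite [d / K]mulrC EFinM muleC; apply: (@le_trans _ _ (mu A * (K^-1 * d)%:E)%E).
  by apply: lee_wpmul2r => //; rewrite lee_fin mulr_ge0 ?invr_ge0 ?ltW.
rewrite muleC mulrC EFinM -muleA lee_pmul2l ?lte_fin//.
by rewrite lee_pdivrMl.
Qed.

Lemma max_chi_ge (B : set (set V)) E S x : B S -> S x ->
  ((fine (mu (S `&` E)) / fine (mu S))%:E <= max_chi B E x)%E.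
Proof.
move=> BS Sx; rewrite /max_chi ifT; first by apply: ereal_sup_ubound; exists S.
by rewrite inE; exists S.
Qed.

(** Positivity of [a] excludes the default value 0 outside the union of [B]. *)
Lemma max_chi_gt (B : set (set V)) E x (a : R) : 0 < a ->
  (a%:E < max_chi B E x)%E -> exists S, [/\ B S, S x &
    a < fine (mu (S `&` E)) / fine (mu S)].
Proof.
move=> a0; rewrite /max_chi; case: ifP => _; last by rewrite ltNge lee_fin ltW.
by move=> /ereal_sup_gt[_ [S [BS Sx] <-]]; rewrite lte_fin; exists S.
Qed.

End Halo.

(** * The halo inclusion *)

Theorem theorem4 (R : realType) (n : nat) (hn : (0 < n)%N) :
  exists c c' : R, 0 < c /\ 0 < c' /\
  forall B : set (set 'rV[R]_n),
    is_basis B -> homothecy_invariant B -> convex_basis B ->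
  forall (alpha : R), 0 < alpha < 1 ->
  forall E : set 'rV[R]_n, leb_measurable E -> (leb_outer E < +oo)%E ->
  forall delta : R, 0 < delta <= c' * (1 - alpha) ->
    halo B alpha E `<=`
    halo B (alpha * (1 + c * (Num.min alpha (1 - alpha)) ^+ (2 * n) * delta))
      (halo B (1 - 3 * powR (n%:R) (3 * n%:R / 2) * delta) E).
Proof.
case: n hn => // n _; have K0 := vitali_const_gt0 R n.
have K1 : 1 <= vitali_const R n by rewrite ler1n -(ltr0n R).
(* The first constant is the gain rate of [dense_copies_gain]; the second gives [d <= 1 - a < 1]. *)
exists (2 * vitali_const R n)^-1, 1; split; first by rewrite invr_gt0 mulr_gt0.
split=> // B basisB homB convB a /andP[a0 a1] E mE Efin d; rewrite mul1r => /andP[d0 da].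
set F := halo B (1 - _ * d) E => x.
move=> /(max_chi_gt a0)[S [BS Sx Sa]].
have [oS bS] := basisB _ BS; have cS := convB _ BS.
have S0 : S !=set0 by exists x.
have Sfin := leb_outer_bounded bS.
have finS X : leb_outer (X `&` S) = (fine (leb_outer (X `&` S)))%:E.
  rewrite fineK// ge0_fin_numE ?leb_outer_ge0//; apply: le_lt_trans Sfin.
  by apply: le_leb_outer; exact: subIsetr.
have muS : leb_outer S = (fine (leb_outer S))%:E by rewrite -[S]setTI -finS.
apply: lt_le_trans (max_chi_ge _ BS Sx); rewrite lte_fin.
rewrite setIC in Sa; rewrite [S `&` F]setIC.
(* With zero volume the quotient in [Sa] would be 0 by the convention on division, not above [a]. *)
have s0 : 0 < fine (leb_outer S).
  rewrite lt_def fine_ge0 ?leb_outer_ge0// andbT.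
  by apply: contraTneq Sa => ->; rewrite invr0 mulr0 ltNge ltW.
(* A copy of [S] belongs to [B], and the power of the dimension is at least 1, so density above
   [1 - 2 * d] exceeds the threshold defining [F]. *)
have dense p : 0 < p.2 ->
    ((1 - 2 * d)%:E * leb_outer (copy S p) < leb_outer (E `&` copy S p))%E ->
    copy S p `<=` F.
  move=> p0 pE y py; apply: lt_le_trans (max_chi_ge E (homB _ BS p.1 _ p0) py).
  have pn : 0 < p.2 ^+ n.+1 by rewrite exprn_gt0.
  have mup : leb_outer (copy S p) = (p.2 ^+ n.+1 * fine (leb_outer S))%:E.
    by rewrite leb_outer_copy// muS -EFinM.
  rewrite setIC lte_fin -/(copy S p) ltr_pdivlMr ?mup/= ?mulr_gt0//.
  rewrite mup -EFinM in pE.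
  rewrite -lte_fin fineK; last first.
    rewrite ge0_fin_numE ?leb_outer_ge0//.
    apply: (@le_lt_trans _ _ (leb_outer (copy S p))); last by rewrite mup ltry.
    by apply: le_leb_outer; exact: subIsetr.
  apply: le_lt_trans pE; rewrite lee_fin ler_pM2r ?mulr_gt0//.
  have : 1 <= n.+1%:R `^ (3 * n.+1%:R / 2) :> R.
    by rewrite -[leLHS](powRr0 n.+1%:R) ler_powR ?ler1n// divr_ge0// mulr_ge0.
  nra.
set m := Num.min a _ ^+ _.
have m1 : 0 <= m <= 1.
  have u0 : 0 <= Num.min a (1 - a) by rewrite le_min ltW//= subr_ge0 ltW.
  by rewrite exprn_ge0//= exprn_ile1// ge_min ltW.
pose cc := (2 * vitali_const R n)^-1.
have c0 : 0 < cc by rewrite invr_gt0 mulr_gt0.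
have c1 : cc <= 1 by rewrite invf_le1 ?mulr_gt0//; lra.
(* Since [m <= 1], replacing it by 1 only raises the threshold to be beaten. *)
have le_gain : a * (1 + cc * m * d) <= a * (1 + cc * d).
  by rewrite ler_pM2l// lerD2l ler_pM2r// ger_pMr//; case/andP: m1.
apply: le_lt_trans le_gain _.
have [ES|SE] := leP (leb_outer (E `&` S)) ((1 - d)%:E * leb_outer S)%E.
  have := dense_copies_gain oS bS cS S0 mE d0 _ ES dense.
  have -> : d < 1 by lra.
  move=> /(_ isT); rewrite finS [X in (_ <= X)%E -> _]finS -EFinM lee_fin => gain.
  rewrite ltr_pdivlMr//; apply: lt_le_trans gain.
  rewrite mulrAC mulrC [cc * d]mulrC ltr_pM2l -?ltr_pdivlMr//.
  by rewrite ltr_pwDr// mulr_gt0.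
(* Here [S], as its own copy of ratio 1, is dense enough to lie in [F], so its average is 1; the
   threshold is at most [a * (2 - a) = 1 - (1 - a) ^+ 2 < 1]. *)
have SF : S `<=` F.
  have := dense (0, 1) ltr01; rewrite /copy/= homothet01; apply.
  apply: le_lt_trans SE; rewrite muS -!EFinM lee_fin ler_pM2r//; lra.
rewrite (setIidr SF) divff ?gt_eqF//.
have cd : cc * d <= 1 - a by apply: le_trans da; rewrite ger_pMl.
apply: (@le_lt_trans _ _ (a * (1 + (1 - a)))); first by rewrite ler_pM2l// lerD2l.
have : 0 < (1 - a) * (1 - a) by rewrite mulr_gt0 ?subr_gt0.
by lra.
Qed.
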